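(* Let $L$ be a locally compact Hausdorff topological space such that $C_0(L)$ is separable, and let $Y$ be a uniformly monotone Banach lattice. Then the pair $(C_0(L),Y)$ has the Bishop-Phelps-Bollobás property for positive operators. Moreover, the function $\eta$ in the definition of this property depends only on the modulus of uniform monotonicity of $Y$; that is, for every function $\delta$ on $(0,1)$ with $0<\delta(\varepsilon)\le\varepsilon$ there is a function $\eta$ on $(0,1)$ with $0<\eta(\varepsilon)<\varepsilon$ such that $\eta$ satisfies the definition of the Bishop-Phelps-Bollobás property for positive operators for $(C_0(L),Y)$ for every locally compact Hausdorff space $L$ with $C_0(L)$ separable and every uniformly monotone Banach lattice $Y$ for which $\delta$ satisfies the definition of uniform monotonicity.
   Context: Banach lattices are real. $C_0(L)$ is the Banach lattice of real-valued continuous functions on $L$ vanishing at infinity, with the supremum norm and pointwise order. For Banach spaces $X,Y$: $S_X$ is the unit sphere of $X$, and $L(X,Y)$ is the space of bounded linear operators from $X$ to $Y$ with the operator norm. An operator $S$ between Banach lattices is positive ($S\ge 0$) if $S(x)\ge 0$ whenever $x\ge 0$; $X^+$ is the set of elements $x\ge 0$ of $X$. Bishop-Phelps-Bollobás property for positive operators: for Banach lattices $X,Y$, the pair $(X,Y)$ has this property if for every $0<\varepsilon<1$ there exists $0<\eta(\varepsilon)<\varepsilon$ such that for every positive $S\in S_{L(X,Y)}$, if $x_0\in S_X$ satisfies $\|S(x_0)\|>1-\eta(\varepsilon)$, then there exist $u_0\in S_X$ and a positive operator $T\in S_{L(X,Y)}$ with $\|T(u_0)\|=1$, $\|u_0-x_0\|<\varepsilon$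 and $\|T-S\|<\varepsilon$. Uniform monotonicity: a Banach lattice $Y$ is uniformly monotone if for every $0<\varepsilon<1$ there is $0<\delta(\varepsilon)\le\varepsilon$ such that for all $x,y\in Y^+$ with $\|x\|=1$ and $\|x+y\|\le 1+\delta(\varepsilon)$ one has $\|y\|\le\varepsilon$. A function $\varepsilon\mapsto\delta(\varepsilon)$ as here is said to satisfy the definition of uniform monotonicity for $Y$ (a modulus of uniform monotonicity). *)

(* Defs.v *)
From HB Require Import structures.
From mathcomp Require Import all_boot all_order all_algebra.
From mathcomp Require Import ring.
From mathcomp Require Import all_classical all_reals all_analysis.

Set Implicit Arguments.
Unset Strict Implicit.
Unset Printing Implicit Defensive.

Import Order.TTheory GRing.Theory Num.Theory.
Import numFieldNormedType.Exports.

Local Open Scope classical_set_scope.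
Local Open Scope ring_scope.

(* The order is a separate relation [vle], not an instance of [Order.POrder]:
   Hierarchy Builder rejects a common substructure of normed modules and
   ordered types that is declared after [Num.NumDomain]. *)
HB.mixin Record CompleteNormedModule_isBanachLattice (R : realType) V
    & CompleteNormedModule R V := {
  vle : V -> V -> Prop;
  vjoin : V -> V -> V;
  vmeet : V -> V -> V;
  vle_refl : forall x : V, vle x x;
  vle_anti : forall x y : V, vle x y -> vle y x -> x = y;
  vle_trans : forall y x z : V, vle x y -> vle y z -> vle x z;
  vle_join : forall x y z : V, vle (vjoin x y) z <-> vle x z /\ vle y z;
  vle_meet : forall x y z : V, vle z (vmeet x y) <-> vle z x /\ vle z y;
  vle_add2r : forall z x y : V, vle x y -> vle (x + z) (y + z);
  vle_scale_ge0 : forall (a : R) (x : V), 0 <= a -> vle 0 x -> vle 0 (a *: x);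
  (* [vjoin x (- x)] is the lattice modulus of [x]. *)
  norm_vle : forall x y : V,
    vle (vjoin x (- x)) (vjoin y (- y)) -> `|x| <= `|y|
}.

#[short(type="banachLatticeType")]
HB.structure Definition BanachLattice (R : realType) :=
  {V of CompleteNormedModule R V & CompleteNormedModule_isBanachLattice R V}.

Notation "x ⊑ y" := (vle x y) (at level 70, no associativity) : ring_scope.

Section C0.
Variables (R : realType) (L : topologicalType).

(* Vanishing at infinity: every set [|f| >= e] with [0 < e] is compact. The
   codomain is [R^o] so that functions form an [R]-module. *)
Definition C0_pred : {pred L -> R^o} :=
  [pred f : L -> R^o | `[< continuous f /\
     forall e : R, 0 < e -> compact [set x | e <= `|f x|] >]].

Record C0 : Type := MkC0 { C0_fun :> L -> R^o ; C0_funP : C0_fun \in C0_pred }.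

HB.instance Definition _ := [isSub for C0_fun].
HB.instance Definition _ := [Choice of C0 by <:].

Lemma C0_predP (f : L -> R^o) : f \in C0_pred <-> continuous f /\
  forall e : R, 0 < e -> compact [set x | e <= `|f x|].
Proof. by rewrite inE; split=> /asboolP H //; apply/asboolP. Qed.

Lemma C0_ext (f g : C0) : (forall x, f x = g x) -> f = g.
Proof. by move=> fg; apply: val_inj; apply/funext. Qed.

Lemma C0_continuous (f : C0) : continuous f.
Proof. by have /C0_predP[] := C0_funP f. Qed.

Lemma C0_compact (f : C0) (e : R) : 0 < e -> compact [set x | e <= `|f x|].
Proof. by have /C0_predP[_] := C0_funP f; exact. Qed.

Lemma closed_norm_ge (f : L -> R^o) (e : R) :
  continuous f -> closed [set x | e <= `|f x|].
Proof.
move=> cf; rewrite (_ : [set x | _] = (fun x => `|f x|) @^-1` [set y | e <= y]) //.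
apply: preimage_closed; last exact: closed_ge.
by move=> x _; apply: cvg_norm; exact: cf.
Qed.

Lemma C0_dominated (f g h : L -> R^o) :
  f \in C0_pred -> g \in C0_pred -> continuous h ->
  (forall x, `|h x| <= `|f x| + `|g x|) -> h \in C0_pred.
Proof.
move=> /C0_predP[cf vf] /C0_predP[cg vg] ch hfg; apply/C0_predP; split => // e e0.
have e20 : 0 < e / 2 by rewrite divr_gt0.
apply: (subclosed_compact (closed_norm_ge ch)
  (compactU (vf _ e20) (vg _ e20))) => x /= ehx.
have [|fx] := leP (e / 2) `|f x|; first by left.
right; rewrite leNgt; apply/negP => gx.
have := le_lt_trans (le_trans ehx (hfg x)) (ltrD fx gx).
by rewrite -splitr ltxx.
Qed.

Lemma C0_pred0 : (0 : L -> R^o) \in C0_pred.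
Proof.
apply/C0_predP; split=> [x|e e0]; first exact: cvg_cst.
rewrite (_ : [set x | _] = set0); first exact: compact0.
by apply/seteqP; split=> // x /=; rewrite normr0 leNgt e0.
Qed.

Lemma C0_submod_closed : submod_closed C0_pred.
Proof.
have Z (a : R) f : f \in C0_pred -> (a *: f) \in C0_pred.
  move=> /[dup] fC /C0_predP[cf vf].
  have ch : continuous (a *: f) by move=> x; apply: cvgZr; exact: cf.
  apply/C0_predP; split => // e e0.
  have a10 : 0 < `|a| + 1 by rewrite ltr_wpDl.
  apply: (subclosed_compact (closed_norm_ge ch) (vf (e / (`|a| + 1)) _)).
    by rewrite divr_gt0.
  move=> x /= h; rewrite ler_pdivrMr// (le_trans h)// normrM mulrC.
  by rewrite ler_wpM2l// lerDl.
split; first exact: C0_pred0.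
move=> a f g fC gC; have afC := Z a _ fC.
apply: (C0_dominated afC gC) => [x|x].
  by apply: cvgD; [have /C0_predP[+ _] := afC|have /C0_predP[+ _] := gC]; exact.
exact: ler_normD.
Qed.

HB.instance Definition _ := GRing.isSubmodClosed.Build R (L -> R^o) C0_pred
  C0_submod_closed.

HB.instance Definition _ := [SubChoice_isSubLmodule of C0 by <:].

(* [sup set0 = 0], so the norm is also right when [L] is empty. *)
Definition C0_norm (f : C0) : R := sup (range (fun x => `|f x|)).

Lemma C0_has_ubound (f : C0) : has_ubound (range (fun x => `|f x|)).
Proof.
have cK : compact (f @` [set x | 1 <= `|f x|]).
  apply: continuous_compact; last exact: C0_compact.
  by apply: continuous_subspaceT; exact: C0_continuous.
have [M [Mr MP]] := compact_bounded cK.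
exists (Num.max 1 (M + 1)) => _ [x _ <-].
have [f1|f1] := leP 1 `|f x|; last by rewrite le_max ltW.
rewrite le_max; apply/orP; right; apply: (MP (M + 1)); first by rewrite ltrDl.
by exists x.
Qed.

Lemma C0_norm_ge (f : C0) x : `|f x| <= C0_norm f.
Proof. by apply: ub_le_sup; [exact: C0_has_ubound|exists x]. Qed.

Lemma C0_norm_ge0 (f : C0) : 0 <= C0_norm f.
Proof.
rewrite /C0_norm; have [->|/set0P[_ [x _ _]]] := eqVneq (range (fun x => `|f x|)) set0.
  by rewrite sup0.
exact: le_trans (C0_norm_ge f x).
Qed.

Lemma C0_norm_le (f : C0) (M : R) :
  0 <= M -> (forall x, `|f x| <= M) -> C0_norm f <= M.
Proof.
move=> M0 fM; rewrite /C0_norm.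
have [->|/set0P ne] := eqVneq (range (fun x => `|f x|)) set0; first by rewrite sup0.
by apply: ge_sup => // _ [x _ <-].
Qed.

Lemma C0_normD (f g : C0) : C0_norm (f + g) <= C0_norm f + C0_norm g.
Proof.
apply: C0_norm_le => [|x]; first by rewrite addr_ge0 ?C0_norm_ge0.
by rewrite (le_trans (ler_normD _ _))// lerD ?C0_norm_ge.
Qed.

Lemma C0_normZ (a : R) (f : C0) : C0_norm (a *: f) = `|a| * C0_norm f.
Proof.
have le b (g : C0) : C0_norm (b *: g) <= `|b| * C0_norm g.
  apply: C0_norm_le => [|x]; first by rewrite mulr_ge0 ?C0_norm_ge0.
  by rewrite [X in X <= _]normrM ler_wpM2l ?C0_norm_ge.
apply/eqP; rewrite eq_le le /=.
have [->|a0] := eqVneq a 0; first by rewrite normr0 mul0r C0_norm_ge0.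
rewrite -ler_pdivlMl ?normr_gt0// -normfV.
by rewrite -{1}[f]scale1r -(mulVf a0) -scalerA le.
Qed.

Lemma C0_norm0_eq0 (f : C0) : C0_norm f = 0 -> f = 0.
Proof.
move=> f0; apply: C0_ext => x; apply/eqP; rewrite -normr_le0.
by have := C0_norm_ge f x; rewrite f0.
Qed.

HB.instance Definition _ := Lmodule_isNormed.Build R C0
  C0_normD C0_normZ C0_norm0_eq0.

Lemma C0_normE (f : C0) : `|f| = sup (range (fun x => `|f x|)).
Proof. by []. Qed.

Lemma C0_complete (F : set_system C0) : ProperFilter F -> cauchy F -> cvg F.
Proof.
move=> PF /cauchyP Fc.
pose ev x (h : C0) : R^o := h x.
have ball_ev (f h : C0) e x : ball f e h -> `|f x - h x| < e.
  rewrite -ball_normE /ball_/= => fh; exact: le_lt_trans (C0_norm_ge (f - h) x) fh.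
have cev x : cvg (ev x @ F).
  apply: cauchy_cvg; apply/cauchyP => e e0; have [f Ff] := Fc _ e0.
  exists (f x); rewrite /fmap /=; apply: filterS Ff => h /ball_ev.
  by rewrite -ball_normE; exact.
pose g x : R^o := lim (ev x @ F).
have gle (f : C0) e x : F (ball f e) -> `|f x - g x| <= e.
  move=> Ff; apply/ler_addgt0Pr => d d0.
  have /cvgrPdist_lt/(_ _ d0) Fd : ev x @ F --> g x by exact: cev.
  have [h [/ball_ev fh gh]] := filter_ex (filterI Ff Fd).
  rewrite (le_trans (ler_distD (h x) _ _))// lerD//; first exact/ltW/fh.
  by rewrite distrC ltW.
have cg : continuous g.
  move=> x; apply/cvgrPdist_le => e e0.
  have e30 : 0 < e / 3 by rewrite divr_gt0.
  have [f Ff] := Fc _ e30.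
  have /cvgrPdist_lt/(_ _ e30) := C0_continuous (f := f) (x := x).
  apply: filterS => y fxy.
  rewrite (le_trans (ler_distD (f x) _ _))//.
  rewrite [leRHS](_ : e = e / 3 + (e / 3 + e / 3)); last by field.
  rewrite lerD//; first by rewrite distrC; exact: gle.
  rewrite (le_trans (ler_distD (f y) _ _))// lerD//; first exact: ltW.
  exact: gle.
have gC : g \in C0_pred.
  apply/C0_predP; split => // e e0.
  have e20 : 0 < e / 2 by rewrite divr_gt0.
  have [f Ff] := Fc _ e20.
  apply: (subclosed_compact (closed_norm_ge cg) (C0_compact (f := f) e20)).
  move=> x /= egx; rewrite -(lerD2r (e / 2)) -splitr (le_trans egx)//.
  rewrite -lerBlDl (le_trans (lerB_dist _ _))// distrC.
  exact: gle.
apply/cvg_ex; exists (MkC0 gC); apply/cvgrPdist_le => e e0.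
have e20 : 0 < e / 2 by rewrite divr_gt0.
have [f Ff] := Fc _ e20.
apply: filterS (Ff) => h; rewrite -ball_normE /ball_ /= => fh.
rewrite (le_trans (ler_distD f _ _))// [leRHS]splitr lerD//; last exact: ltW.
rewrite [leLHS]C0_normE; apply: C0_norm_le => [|x]; first exact: ltW.
by rewrite distrC; exact: gle.
Qed.

HB.instance Definition _ := Uniform_isComplete.Build C0 C0_complete.

Definition C0_le (f g : C0) : Prop := forall x, f x <= g x.

Lemma C0_max_subproof (f g : C0) :
  (fun x => Num.max (f x) (g x) : R^o) \in C0_pred.
Proof.
apply: (C0_dominated (C0_funP f) (C0_funP g)) => [x|x].
  by apply: (@continuous_max R L (f : L -> R) (g : L -> R)); exact: C0_continuous.
by rewrite /Num.max; case: ifP => _; [rewrite lerDr|rewrite lerDl].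
Qed.

Lemma C0_min_subproof (f g : C0) :
  (fun x => Num.min (f x) (g x) : R^o) \in C0_pred.
Proof.
apply: (C0_dominated (C0_funP f) (C0_funP g)) => [x|x].
  by apply: (@continuous_min R L (f : L -> R) (g : L -> R)); exact: C0_continuous.
by rewrite /Num.min; case: ifP => _; [rewrite lerDl|rewrite lerDr].
Qed.

Definition C0_max (f g : C0) : C0 := MkC0 (C0_max_subproof f g).
Definition C0_min (f g : C0) : C0 := MkC0 (C0_min_subproof f g).

Lemma C0_le_refl (f : C0) : C0_le f f.
Proof. by move=> x. Qed.

Lemma C0_le_anti (f g : C0) : C0_le f g -> C0_le g f -> f = g.
Proof. by move=> fg gf; apply: C0_ext => x; apply/le_anti; rewrite fg gf. Qed.

Lemma C0_le_trans (g f h : C0) : C0_le f g -> C0_le g h -> C0_le f h.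
Proof. by move=> fg gh x; exact: le_trans (fg x) (gh x). Qed.

Lemma C0_le_max (f g h : C0) : C0_le (C0_max f g) h <-> C0_le f h /\ C0_le g h.
Proof.
split=> [H|[fh gh] x]; last by rewrite ge_max fh gh.
by split=> x; have := H x; rewrite ge_max => /andP[].
Qed.

Lemma C0_le_min (f g h : C0) : C0_le h (C0_min f g) <-> C0_le h f /\ C0_le h g.
Proof.
split=> [H|[fh gh] x]; last by rewrite le_min fh gh.
by split=> x; have := H x; rewrite le_min => /andP[].
Qed.

Lemma C0_le_add2r (h f g : C0) : C0_le f g -> C0_le (f + h) (g + h).
Proof. by move=> fg x; rewrite lerD2r. Qed.

Lemma C0_le_scale (a : R) (f : C0) : 0 <= a -> C0_le 0 f -> C0_le 0 (a *: f).
Proof. by move=> a0 f0 x; rewrite mulr_ge0// f0. Qed.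

Lemma C0_norm_mono (f g : C0) :
  C0_le (C0_max f (- f)) (C0_max g (- g)) -> `|f| <= `|g|.
Proof.
move=> fg; rewrite [leLHS]C0_normE; apply: C0_norm_le => // x.
have max_norm (a : R) : Num.max a (- a) = `|a| := maxrN a.
have := fg x; rewrite /= !max_norm => /le_trans; apply; exact: C0_norm_ge.
Qed.

HB.instance Definition _ := CompleteNormedModule_isBanachLattice.Build R C0
  C0_le_refl C0_le_anti C0_le_trans C0_le_max C0_le_min C0_le_add2r C0_le_scale
  C0_norm_mono.

End C0.

Definition separable (T : topologicalType) : Prop :=
  exists2 D : set T, countable D & dense D.

Section operators.
Variable R : realType.

Definition bounded_operator (X Y : normedModType R) (T : X -> Y) : Prop :=
  exists M : R, forall x, `|T x| <= M * `|x|.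

(* Meaningful for bounded [T] only: [sup] of an unbounded set is [0]. *)
Definition opnorm (X Y : normedModType R) (T : X -> Y) : R :=
  sup [set `|T x| | x in [set x | `|x| <= 1]].

Definition positive_operator (X Y : banachLatticeType R) (T : X -> Y) : Prop :=
  forall x, 0 ⊑ x -> 0 ⊑ T x.

Definition unit_positive_operator (X Y : banachLatticeType R)
    (T : {linear X -> Y}) : Prop :=
  [/\ bounded_operator T, opnorm T = 1 & positive_operator T].

Definition BPBp_positive_at (X Y : banachLatticeType R) (eps eta : R) : Prop :=
  forall S : {linear X -> Y}, unit_positive_operator S ->
  forall x0 : X, `|x0| = 1 -> 1 - eta < `|S x0| ->
  exists (u0 : X) (T : {linear X -> Y}),
    [/\ `|u0| = 1, unit_positive_operator T, `|T u0| = 1,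
        `|u0 - x0| < eps & opnorm (T \- S) < eps].

Definition BPBp_positive (X Y : banachLatticeType R) : Prop :=
  forall eps : R, 0 < eps < 1 ->
  exists2 eta : R, 0 < eta < eps & BPBp_positive_at X Y eps eta.

Definition BPBp_positive_function (X Y : banachLatticeType R) (eta : R -> R) :
    Prop :=
  forall eps : R, 0 < eps < 1 ->
  0 < eta eps < eps /\ BPBp_positive_at X Y eps (eta eps).

Definition uniform_monotonicity_at (Y : banachLatticeType R) (eps delta : R) :
    Prop :=
  forall x y : Y, 0 ⊑ x -> 0 ⊑ y -> `|x| = 1 -> `|x + y| <= 1 + delta ->
  `|y| <= eps.

Definition uniformly_monotone (Y : banachLatticeType R) : Prop :=
  forall eps : R, 0 < eps < 1 ->
  exists2 delta : R, 0 < delta <= eps & uniform_monotonicity_at Y eps delta.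

Definition uniform_monotonicity_modulus (Y : banachLatticeType R)
    (delta : R -> R) : Prop :=
  forall eps : R, 0 < eps < 1 ->
  0 < delta eps <= eps /\ uniform_monotonicity_at Y eps (delta eps).

End operators.

(* Main.v *)
From HB Require Import structures.
Require Import Defs.
From mathcomp Require Import all_boot all_order all_algebra.
From mathcomp Require Import all_classical all_reals all_analysis.
From mathcomp Require Import ring lra.

Set Implicit Arguments.
Unset Strict Implicit.
Unset Printing Implicit Defensive.

Import Order.TTheory GRing.Theory Num.Theory.
Import numFieldNormedType.Exports.

Local Open Scope classical_set_scope.
Local Open Scope ring_scope.

(** Let [S >= 0] have norm one and let [x0] be a unit vector with [|S x0|]
    close to one. The lattice modulus of [S x0] lies below [S |x0|], whose norm
    is at most one, so uniform monotonicity of [Y] makes two things small: the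
    gap between them, which is twice the overlap [S (x0^+) /\ S (x0^-)], and the
    image under [S] of every positive [g] with [| |x0| + g | <= 1]
    ([overlap_small] and [complement_small]).

    Over [C_0(L)] the second fact says that [S] almost lives on the set where
    [|x0|] is close to one. Put [c = 1 - eps / 2] and let [p] and [q] be the
    continuous functions of [x0] that ramp linearly from [0] at the level [c] to
    [1] at the level [1], for [x0] and for [- x0] respectively. Then
    [|x0| + (1 - c) (1 - p - q) <= 1], so [S f] is close to [S (f p) + S (f q)]
    uniformly on the unit ball. The first fact says that the images of the
    positive and the negative part are almost disjoint; they become exactly
    disjoint after splitting [Y] with the band projection [P] onto the band of
    [(S x0)^+], and [Q = id - P], at the price of an error of the size of the
    overlap ([separating_projection]). The operator
      [T1 f = P (S (f p)) + Q (S (f q))]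
    is therefore positive and close to [S]. Let [u0] be [x0 / c] truncated to
    [[-1, 1]]. It equals [1] where [p > 0] and [-1] where [q > 0], hence
    [T1 u0 = P (S p) - Q (S q)], and by disjointness the modulus of [T1 u0] is
    [P (S p) + Q (S q)], which dominates [T1 f] for every [f] in the unit ball:
    [T1] attains its norm at [u0]. Normalizing [T1] gives the required operator
    ([BPB_normalization]).

    A uniformly monotone lattice has the band projections of single elements:
    bounded increasing sequences of positive elements are Cauchy
    ([nondecreasing_cauchy]), so the component [sup_n (x /\ n z)] of a positive
    [x] in the band of [z] exists.

    Monotonicity is used at the level [eps^2 / 8] only: if [d] is the modulus at
    that level then [eta = d / 2], which depends on the modulus alone. *)

#[local] Arguments vle_trans {R s} y {x z} _ _.
#[local] Arguments vle_anti {R s x y} _ _.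
#[local] Arguments vle_refl {R s} x.

(** * Vector lattice identities and the norm *)

Section lattice.
Variables (R : realType) (Y : banachLatticeType R).
Implicit Types x y z u v w : Y.

Lemma vleD x y z u : x ⊑ y -> z ⊑ u -> x + z ⊑ y + u.
Proof.
move=> xy zu; apply: (vle_trans (y + z)); first exact: vle_add2r.
by rewrite ![y + _]addrC; exact: vle_add2r.
Qed.

Lemma vle_subl x y z : x - y ⊑ z <-> x ⊑ z + y.
Proof.
by split=> [/(vle_add2r y)|/(vle_add2r (- y))]; rewrite ?subrK ?addrK.
Qed.

Lemma vle_subr x y z : x ⊑ y - z <-> x + z ⊑ y.
Proof.
by split=> [/(vle_add2r z)|/(vle_add2r (- z))]; rewrite ?subrK ?addrK.
Qed.

Lemma vsub_ge0 x y : 0 ⊑ y - x <-> x ⊑ y.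
Proof. by rewrite vle_subr add0r. Qed.

Lemma vleN x y : x ⊑ y -> - y ⊑ - x.
Proof. by move=> xy; rewrite -vsub_ge0 opprK addrC vsub_ge0. Qed.

Lemma vle_scale (a : R) x y : 0 <= a -> x ⊑ y -> a *: x ⊑ a *: y.
Proof.
by move=> a0 xy; rewrite -vsub_ge0 -scalerBr; apply: vle_scale_ge0 => //;
  rewrite vsub_ge0.
Qed.

Lemma vge0D x y : 0 ⊑ x -> 0 ⊑ y -> 0 ⊑ x + y.
Proof. by move=> x0 /(vleD x0); rewrite addr0. Qed.

Lemma vle_addl x y : 0 ⊑ y -> x ⊑ y + x.
Proof. by move=> /(vle_add2r x); rewrite add0r. Qed.

Lemma vle_addr x y : 0 ⊑ y -> x ⊑ x + y.
Proof. by rewrite addrC; exact: vle_addl. Qed.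

Lemma vle_joinl x y : x ⊑ vjoin x y.
Proof. by have /vle_join[] := vle_refl (vjoin x y). Qed.

Lemma vle_joinr x y : y ⊑ vjoin x y.
Proof. by have /vle_join[] := vle_refl (vjoin x y). Qed.

Lemma vle_meetl x y : vmeet x y ⊑ x.
Proof. by have /vle_meet[] := vle_refl (vmeet x y). Qed.

Lemma vle_meetr x y : vmeet x y ⊑ y.
Proof. by have /vle_meet[] := vle_refl (vmeet x y). Qed.

Lemma vmeetC x y : vmeet x y = vmeet y x.
Proof.
by apply: vle_anti; rewrite vle_meet; split;
  (exact: vle_meetl || exact: vle_meetr).
Qed.

Lemma vmeet_mono x y z u : x ⊑ y -> z ⊑ u -> vmeet x z ⊑ vmeet y u.
Proof.
move=> xy zu; apply/vle_meet; split.
  exact: vle_trans _ (vle_meetl _ _) xy.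
exact: vle_trans _ (vle_meetr _ _) zu.
Qed.

Lemma vmeetDr x y z : vmeet x y + z = vmeet (x + z) (y + z).
Proof.
apply: vle_anti.
  by apply/vle_meet; split; apply: vle_add2r;
    [exact: vle_meetl|exact: vle_meetr].
rewrite -vle_subl; apply/vle_meet; rewrite !vle_subl; split;
  [exact: vle_meetl|exact: vle_meetr].
Qed.

Lemma vmeet_ge0 x y : 0 ⊑ x -> 0 ⊑ y -> 0 ⊑ vmeet x y.
Proof. by rewrite vle_meet. Qed.

Lemma vjoinDmeet x y : vjoin x y + vmeet x y = x + y.
Proof.
apply: vle_anti.
  rewrite -vle_subr; apply/vle_join; rewrite !vle_subr; split.
    by apply: vleD; [exact: vle_refl|exact: vle_meetr].
  by rewrite addrC; apply: vleD; [exact: vle_meetl|exact: vle_refl].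
rewrite [X in _ ⊑ X]addrC -vle_subl; apply/vle_meet; rewrite !vle_subl; split.
  by apply: vleD; [exact: vle_refl|exact: vle_joinr].
by rewrite addrC; apply: vleD; [exact: vle_refl|exact: vle_joinl].
Qed.

(** By [vmeetDr], twice, the right-hand side is the meet of [x + y], [x + z],
    [z + y] and [z + z], each of which is above the left-hand side. *)
Lemma vmeet_subadd x y z : 0 ⊑ x -> 0 ⊑ y -> 0 ⊑ z ->
  vmeet (x + y) z ⊑ vmeet x z + vmeet y z.
Proof.
move=> x0 y0 z0; rewrite vmeetDr vle_meet; split.
  rewrite [X in _ ⊑ X]addrC vmeetDr.
  apply: vmeet_mono; first by rewrite addrC; exact: vle_refl.
  exact: vle_addr.
apply: (vle_trans _ (vle_meetr _ _)); apply: vle_addr; exact: vmeet_ge0.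
Qed.

Definition vabs x : Y := vjoin x (- x).

Lemma vabs_le x y : x ⊑ y -> - x ⊑ y -> vabs x ⊑ y.
Proof. by move=> ? ?; apply/vle_join. Qed.

Lemma vabs_ge0 x : 0 ⊑ vabs x.
Proof.
rewrite (_ : vabs x = 2^-1 *: (vabs x + vabs x)).
  apply: vle_scale_ge0; first by rewrite invr_ge0.
  by rewrite -(subrr x); apply: vleD; [exact: vle_joinl|exact: vle_joinr].
by rewrite -[X in _ *: (X + X)]scale1r -scalerDl scalerA mulVf ?scale1r.
Qed.

Lemma ge0_vabs x : 0 ⊑ x -> vabs x = x.
Proof.
move=> x0; apply: vle_anti; last exact: vle_joinl.
apply: vabs_le; first exact: vle_refl.
by apply: (vle_trans 0) => //; rewrite -oppr0; exact: vleN.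
Qed.

Lemma norm_dominated x y : x ⊑ y -> - x ⊑ y -> `|x| <= `|y|.
Proof.
move=> xy nxy; apply: norm_vle; apply: (vle_trans _ (vabs_le xy nxy)).
exact: vle_joinl.
Qed.

Lemma norm_mono x y : 0 ⊑ x -> x ⊑ y -> `|x| <= `|y|.
Proof.
move=> x0 xy; apply: norm_dominated => //; apply: (vle_trans _ _ xy).
by apply: (vle_trans 0) => //; rewrite -oppr0; exact: vleN.
Qed.

Lemma norm_vabs x : `|vabs x| = `|x|.
Proof.
have e := ge0_vabs (vabs_ge0 x).
apply: le_anti; apply/andP; split; apply: norm_vle.
  by move: (vle_refl (vabs x)); rewrite -{1}e.
by move: (vle_refl (vabs x)); rewrite -{2}e.
Qed.

(** The exact defect in [|x - y| <= x + y] for positive [x] and [y]; this is how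
    the overlap [x /\ y] enters the norm estimates. *)
Lemma vabs_sub x y : vabs (x - y) + vmeet x y *+ 2 = x + y.
Proof.
have dbl z : z *+ 2 = 2%:R *: z by rewrite scaler_nat.
suff -> : vabs (x - y) = vjoin x y *+ 2 - (x + y).
  by rewrite addrAC -mulrnDl vjoinDmeet mulr2n addrK.
apply: vle_anti.
  apply: vabs_le; rewrite vle_subr ?opprB.
    by rewrite addrACA addNr addr0; apply: vleD; exact: vle_joinl.
  by rewrite [x + y]addrC addrACA addNr addr0; apply: vleD; exact: vle_joinr.
rewrite vle_subl dbl.
rewrite -[X in _ ⊑ X](@scalerKV _ _ 2) ?pnatr_eq0//; apply: vle_scale => //.
have half u v : u *+ 2 ⊑ v -> u ⊑ 2^-1 *: v.
  move=> /(@vle_scale 2^-1); rewrite dbl scalerA mulVf ?scale1r ?pnatr_eq0//.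
  by apply; rewrite invr_ge0.
rewrite vle_join; split; apply: half; rewrite mulr2n -vle_subl.
  by rewrite [X in X ⊑ _](_ : _ = x - y); [exact: vle_joinl|
    rewrite opprD addrACA subrr add0r].
by rewrite [X in X ⊑ _](_ : _ = - (x - y)); [exact: vle_joinr|
  rewrite opprD addrACA subrr addr0 opprB].
Qed.

Lemma vabs_sub_disjoint x y : 0 ⊑ x -> 0 ⊑ y -> vmeet x y ⊑ 0 ->
  vabs (x - y) = x + y.
Proof.
move=> x0 y0 xy; rewrite -(vabs_sub x y) (vle_anti xy (vmeet_ge0 x0 y0)).
by rewrite mul0rn addr0.
Qed.

Definition vpos x : Y := vjoin x 0.

Lemma vpos_ge0 x : 0 ⊑ vpos x.
Proof. exact: vle_joinr. Qed.

Lemma sub_meet x y : x - vmeet x y = vpos (x - y).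
Proof.
apply: vle_anti.
  rewrite vle_subl addrC -vle_subl vle_meet; split.
    by rewrite vle_subl; apply: vle_addr; exact: vpos_ge0.
  by rewrite vle_subl addrC -vle_subl; exact: vle_joinl.
apply/vle_join; split; last by rewrite vsub_ge0; exact: vle_meetl.
apply: vleD; first exact: vle_refl.
by apply: vleN; exact: vle_meetr.
Qed.

Lemma vpos_sub x : vpos x - vpos (- x) = x.
Proof.
have := sub_meet x 0; rewrite subr0 => <-.
by have := sub_meet 0 x; rewrite !sub0r => <-; rewrite vmeetC opprK subrK.
Qed.

Lemma vabs_pos_neg x : vabs x = vpos x + vpos (- x).
Proof.
rewrite -(vabs_sub_disjoint (vpos_ge0 _) (vpos_ge0 _)) ?vpos_sub//.
have {1}-> : vpos x = x - vmeet x 0 by rewrite sub_meet subr0.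
have -> : vpos (- x) = 0 - vmeet x 0 by rewrite vmeetC sub_meet sub0r.
by rewrite -vmeetDr subrr; exact: vle_refl.
Qed.

(** The positive cone is closed because [(w - v)^+ <= |u n - v|] as soon as
    [w <= u n]. *)
Lemma vle_lim (u : nat -> Y) v w : u @ \oo --> v ->
  (\forall n \near \oo, w ⊑ u n) -> w ⊑ v.
Proof.
move=> uv wu.
suff : vpos (w - v) = 0.
  by move=> e; rewrite -vsub_ge0 -opprB -oppr0 -{1}e; apply: vleN; exact: vle_joinl.
apply/eqP; rewrite -normr_le0; apply/ler_addgt0Pr => e e0; rewrite add0r.
have /cvgrPdist_lt/(_ _ e0) due := uv.
have [n [wn dn]] := filter_ex (filterI wu due).
apply: le_trans (ltW dn); rewrite distrC -[leRHS]norm_vabs.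
apply: norm_mono; first exact: vpos_ge0.
apply/vle_join; split; last exact: vabs_ge0.
apply: (vle_trans (u n - v)); first exact: vle_add2r.
exact: vle_joinl.
Qed.

End lattice.

(** * Band projections in a uniformly monotone lattice *)

Section uniformly_monotone_lattice.
Variables (R : realType) (Y : banachLatticeType R).
Implicit Types x y z u v w : Y.

Lemma uniform_monotonicity_scaled (e d : R) x y :
  uniform_monotonicity_at Y e d -> 0 ⊑ x -> 0 ⊑ y -> 0 < `|x| ->
  `|x + y| <= (1 + d) * `|x| -> `|y| <= e * `|x|.
Proof.
move=> um x0 y0 nx0 xy.
have inv0 : 0 <= `|x|^-1 by rewrite invr_ge0.
have nZ u : `| `|x|^-1 *: u| = `|u| / `|x| by rewrite normrZ ger0_norm// mulrC.
rewrite -ler_pdivrMr// -nZ; apply: um (vle_scale_ge0 _ _ inv0 x0) _ _ _.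
- exact: vle_scale_ge0.
- by rewrite nZ divff// gt_eqF.
- by rewrite -scalerDr nZ ler_pdivrMr.
Qed.

Lemma nondecreasing_vle (u : nat -> Y) : (forall n, u n ⊑ u n.+1) ->
  forall m n, (m <= n)%N -> u m ⊑ u n.
Proof.
move=> incr m n /subnK <-; elim: (n - m)%N => [|k IH]; first exact: vle_refl.
exact: vle_trans IH (incr _).
Qed.

Hypothesis um : uniformly_monotone Y.

(** The norms increase to a finite supremum. From an index at which the norm is
    within a factor [1 + d] of it, uniform monotonicity leaves no room for an
    increment of norm more than [e]. *)
Lemma nondecreasing_cauchy (u : nat -> Y) w : (forall n, u n ⊑ u n.+1) ->
  (forall n, 0 ⊑ u n) -> (forall n, u n ⊑ w) ->
  forall e : R, 0 < e -> exists N, forall m, (N <= m)%N -> `|u N - u m| <= e.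
Proof.
move=> incr u0 uw e e0.
have mono := nondecreasing_vle incr.
pose A := range (fun n => `|u n|).
have ubA : has_ubound A by exists `|w| => _ [n _ <-]; exact: norm_mono.
have supA : has_sup A by split => //; exists `|u 0%N|, 0%N.
have unA n : `|u n| <= sup A by apply: ub_le_sup => //; exists n.
have [M0|M0] := leP (sup A) 0.
  exists 0%N => m _.
  have u00 k : u k = 0.
    by apply/eqP; rewrite -normr_le0; exact: le_trans (unA k) M0.
  by rewrite !u00 subrr normr0 ltW.
pose e' := Num.min 2^-1 (e / sup A).
have e'0 : 0 < e' < 1.
  rewrite lt_min invr_gt0 ltr0n divr_gt0//= gt_min; apply/orP; left.
  by rewrite invf_lt1// ltr1n.
have [d /andP[d0 _] umd] := um e'0.
have d10 : 0 < 1 + d by rewrite addr_gt0.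
have [|_ [N _ <-] hN] := @sup_adherent _ A (sup A - sup A / (1 + d)) _ supA.
  by rewrite subr_gt0 ltr_pdivrMr// ltr_pMr// ltrDl.
rewrite subKr ltr_pdivrMr// in hN.
have uN0 : 0 < `|u N|.
  by rewrite -(pmulr_lgt0 _ d10); apply: lt_trans hN.
exists N => m Nm; rewrite distrC.
apply: (le_trans (uniform_monotonicity_scaled umd (u0 N) _ uN0 _)).
- by rewrite vsub_ge0; exact: mono.
- by rewrite addrC subrK (le_trans (unA m))// mulrC ltW.
- apply: (@le_trans _ _ (e / sup A * `|u N|)).
    by rewrite ler_wpM2r// ge_min lexx orbT.
  by rewrite mulrAC ler_pdivrMr// ler_pM2l.
Qed.

Lemma nondecreasing_has_vsup (u : nat -> Y) w : (forall n, u n ⊑ u n.+1) ->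
  (forall n, 0 ⊑ u n) -> (forall n, u n ⊑ w) ->
  exists s, (forall n, u n ⊑ s) /\ forall v, (forall n, u n ⊑ v) -> s ⊑ v.
Proof.
move=> incr u0 uw.
have /cauchy_cvgP/cvg_ex[s us] : cauchy (u @ \oo).
  apply: cauchy_exP => e e0.
  have e20 : 0 < e / 2 by rewrite divr_gt0.
  have [N hN] := nondecreasing_cauchy incr u0 uw e20.
  exists (u N), N => // m /= Nm; rewrite -ball_normE /ball_/=.
  by rewrite (le_lt_trans (hN _ Nm))// ltr_pdivrMr// ltr_pMr// ltr1n.
exists s; split=> [n|v uv].
  by apply: (vle_lim us); exists n => // m /= nm; exact: nondecreasing_vle.
have -> : v = - - v by rewrite opprK.
rewrite -[s]opprK; apply: vleN.
apply: (@vle_lim _ _ (fun n => - u n)); first exact: cvgN.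
by apply: nearW => n; exact: vleN.
Qed.

Lemma band_component_exists z : 0 ⊑ z -> exists p : Y -> Y, forall x, 0 ⊑ x ->
  (forall n, vmeet x (z *+ n) ⊑ p x) /\
  (forall v, (forall n, vmeet x (z *+ n) ⊑ v) -> p x ⊑ v).
Proof.
move=> z0.
have zn0 n : 0 ⊑ z *+ n.
  by rewrite -scaler_nat; exact: vle_scale_ge0.
suff H x : exists s, 0 ⊑ x -> (forall n, vmeet x (z *+ n) ⊑ s) /\
    (forall v, (forall n, vmeet x (z *+ n) ⊑ v) -> s ⊑ v).
  by have [p pP] := choice H; exists p.
have [x0|nx0] := pselect (0 ⊑ x); last by exists 0.
have [|n|n|s sP] := @nondecreasing_has_vsup (fun n => vmeet x (z *+ n)) x.
- move=> n; apply: vmeet_mono; first exact: vle_refl.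
  by rewrite mulrS; exact: vle_addl.
- exact: vmeet_ge0.
- exact: vle_meetl.
- by exists s.
Qed.

(** Well-definedness of [P (x - y) = p x - p y] on differences of positive
    elements is additivity of [p] applied to [x + (x - y)^- = y + (x - y)^+]. *)
Lemma positive_additive_extension (p : Y -> Y) :
  (forall x y, 0 ⊑ x -> 0 ⊑ y -> p (x + y) = p x + p y) ->
  (forall (a : R) x, 0 < a -> 0 ⊑ x -> p (a *: x) = a *: p x) ->
  exists P : {linear Y -> Y}, forall x, 0 ⊑ x -> P x = p x.
Proof.
move=> pD pZ.
have p0 : p 0 = 0.
  have := pD 0 0 (vle_refl 0) (vle_refl 0); rewrite addr0 => /esym/eqP.
  by rewrite -subr_eq0 addrK => /eqP.
pose P x := p (vpos x) - p (vpos (- x)).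
have PE x y : 0 ⊑ x -> 0 ⊑ y -> P (x - y) = p x - p y.
  move=> x0 y0; apply/eqP; rewrite subr_eq addrAC eq_sym subr_eq; apply/eqP.
  rewrite -!pD//; try exact: vpos_ge0.
  congr p; apply/eqP; rewrite -subr_eq addrAC eq_sym -subr_eq; apply/eqP.
  by rewrite vpos_sub.
have pos x : 0 ⊑ vpos x := vpos_ge0 x.
have PN x : P (- x) = - P x by rewrite /P opprK opprB.
have PD x y : P (x + y) = P x + P y.
  rewrite -{1}[x]vpos_sub -{1}[y]vpos_sub addrACA -opprD PE ?pD//;
    try exact: vge0D.
  by rewrite opprD addrACA.
have PpZ (a : R) x : 0 < a -> P (a *: x) = a *: P x.
  move=> a0; rewrite -{1}[x]vpos_sub scalerBr PE ?pZ -?scalerBr//;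
    exact: (vle_scale_ge0 _ _ (ltW a0) (pos _)).
have PZ (a : R) x : P (a *: x) = a *: P x.
  have [a0|a0|->] := ltgtP a 0; last by rewrite !scale0r /P oppr0 subrr.
  - by rewrite -[a]opprK scaleNr PN PpZ ?oppr_gt0// -scaleNr.
  - exact: PpZ.
have Plin : linear P by move=> a x y; rewrite PD PZ.
pose Pl := GRing.isLinear.Build R Y Y *:%R P Plin.
have [PL PLE] : exists PL : {linear Y -> Y}, PL =1 P.
  by exists (HB.pack_for {linear Y -> Y} P Pl).
exists PL => x x0; rewrite PLE.
rewrite -{1}[x]subr0 PE ?p0 ?subr0//; exact: vle_refl.
Qed.

Lemma vmeet_mulrn x z n : 0 ⊑ x -> 0 ⊑ z -> vmeet x z ⊑ 0 ->
  vmeet x (z *+ n) ⊑ 0.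
Proof.
move=> x0 z0 xz; have zn0 k : 0 ⊑ z *+ k.
  by rewrite -scaler_nat; exact: vle_scale_ge0.
elim: n => [|n IH]; first by rewrite mulr0n; exact: vle_meetr.
rewrite mulrS vmeetC; apply: (vle_trans _ (vmeet_subadd z0 (zn0 n) x0)).
by rewrite -(addr0 0) ![vmeet _ x]vmeetC; exact: vleD.
Qed.

(** All properties of the component map [p x = sup_n (x /\ n z)] follow from its
    being a least upper bound. For disjointness: [t = (w - p w) /\ z] satisfies
    [w /\ n z + t <= w /\ (n + 1) z <= p w] for all [n], so [p w + t <= p w];
    thus [w - p w] is disjoint from every [n z], and an element [t] below both
    [p v] and [w - p w] satisfies
    [v /\ n z + t <= (v /\ n z) \/ t <= p v], so [t <= 0]. *)
Lemma band_projection z : 0 ⊑ z -> exists P : {linear Y -> Y},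
  [/\ forall x, 0 ⊑ x -> 0 ⊑ P x /\ P x ⊑ x,
      forall v w, 0 ⊑ v -> 0 ⊑ w -> vmeet (P v) (w - P w) ⊑ 0,
      z ⊑ P z &
      forall x, 0 ⊑ x -> vmeet x z ⊑ 0 -> P x ⊑ 0].
Proof.
move=> z0; have [p pP] := band_component_exists z0.
have zn0 n : 0 ⊑ z *+ n by rewrite -scaler_nat; exact: vle_scale_ge0.
have pub x n : 0 ⊑ x -> vmeet x (z *+ n) ⊑ p x by move=> /pP[].
have plub x v : 0 ⊑ x -> (forall n, vmeet x (z *+ n) ⊑ v) -> p x ⊑ v.
  by move=> /pP[_]; exact.
have p_ge0 x : 0 ⊑ x -> 0 ⊑ p x.
  by move=> x0; apply: (vle_trans _ _ (pub x 0%N x0)); exact: vmeet_ge0.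
have p_le x : 0 ⊑ x -> p x ⊑ x by move=> x0; apply: (plub) => // n; exact: vle_meetl.
have pD x y : 0 ⊑ x -> 0 ⊑ y -> p (x + y) = p x + p y.
  move=> x0 y0; have xy0 := vge0D x0 y0; apply: vle_anti.
    apply: (plub) => // n; apply: (vle_trans _ (vmeet_subadd x0 y0 (zn0 n))).
    by apply: vleD; exact: pub.
  rewrite -vle_subr; apply: (plub) => // n; rewrite vle_subr addrC -vle_subr.
  apply: (plub) => // m; rewrite vle_subr.
  apply: (vle_trans _ _ (pub _ (m + n)%N xy0)); apply/vle_meet; split.
    by rewrite [x + y]addrC; apply: vleD; exact: vle_meetl.
  by rewrite mulrnDr; apply: vleD; exact: vle_meetr.
(* One inequality suffices, as it also applies to [a^-1]; an integer above
   [c^-1 * n] replaces the exact multiple [(n / c) z]. *)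
have pZ (a : R) x : 0 < a -> 0 ⊑ x -> p (a *: x) = a *: p x.
  have le c y : 0 < c -> 0 ⊑ y -> p (c *: y) ⊑ c *: p y.
    move=> c0 y0; have cV0 : 0 <= c^-1 by rewrite invr_ge0 ltW.
    have cy0 := vle_scale_ge0 _ _ (ltW c0) y0.
    have cK u : c *: (c^-1 *: u) = u by rewrite scalerA divff ?scale1r ?gt_eqF.
    apply: (plub) => // n; rewrite -[X in X ⊑ _]cK.
    apply: vle_scale; first exact: ltW.
    pose m := Num.bound (c^-1 * n%:R).
    apply: (vle_trans _ _ (pub _ m y0)); apply/vle_meet; split.
      have {2}-> : y = c^-1 *: (c *: y) by rewrite scalerA mulVf ?scale1r ?gt_eqF.
      by apply: vle_scale => //; exact: vle_meetl.
    apply: (vle_trans (c^-1 *: (z *+ n))).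
      by apply: vle_scale => //; exact: vle_meetr.
    rewrite -![z *+ _]scaler_nat scalerA -vsub_ge0 -scalerBl.
    apply: vle_scale_ge0 => //.
    by rewrite subr_ge0 ltW// archi_boundP// mulr_ge0.
  move=> a0 x0; have ax0 := vle_scale_ge0 _ _ (ltW a0) x0.
  apply: vle_anti; first exact: le.
  have aV0 : 0 < a^-1 by rewrite invr_gt0.
  have := vle_scale (ltW a0) (le _ _ aV0 ax0).
  by rewrite !scalerA mulVf ?divff ?scale1r ?gt_eqF.
have [P PE] := positive_additive_extension pD pZ; exists P.
have Pdisj w : 0 ⊑ w -> vmeet (w - p w) z ⊑ 0.
  move=> w0; set t := vmeet _ _.
  have : p w ⊑ p w - t; last by rewrite vle_subr addrC -vle_subr subrr.
  apply: (plub) => // n; rewrite vle_subr.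
  apply: (vle_trans _ _ (pub w n.+1 w0)); apply/vle_meet; split.
    have {2}-> : w = p w + (w - p w) by rewrite addrC subrK.
    by apply: vleD; [exact: pub|exact: vle_meetl].
  by rewrite mulrSr; apply: vleD; exact: vle_meetr.
split.
- by move=> x x0; rewrite PE//; split; [exact: p_ge0|exact: p_le].
- move=> v w v0 w0; rewrite !PE//; set t := vmeet _ _.
  have d0 : 0 ⊑ w - p w by rewrite vsub_ge0; exact: p_le.
  have : p v ⊑ p v - t; last by rewrite vle_subr addrC -vle_subr subrr.
  apply: (plub) => // n; rewrite vle_subr -vjoinDmeet.
  rewrite -[X in _ ⊑ X]addr0; apply: vleD.
    by apply/vle_join; split; [exact: pub|exact: vle_meetl].
  apply: (vle_trans _ _ (vmeet_mulrn n d0 z0 (Pdisj w w0))).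
  by rewrite vmeetC; apply: vmeet_mono; exact: vle_meetr.
- rewrite PE//; apply: (vle_trans _ _ (pub z 1%N z0)).
  by apply/vle_meet; split; exact: vle_refl.
- move=> x x0 xz; rewrite PE//; apply: (plub) => // n; exact: vmeet_mulrn.
Qed.

(** [P] projects onto the band of [z = a - a /\ b]. The element [b - a /\ b] is
    disjoint from [z], so what [Q] leaves of [a] and what [P] leaves of [b] both
    come from the common part [a /\ b]. *)
Lemma separating_projection a b : 0 ⊑ a -> 0 ⊑ b ->
  exists P Q : {linear Y -> Y},
  [/\ positive_operator P /\ positive_operator Q,
      forall x, P x + Q x = x,
      forall v w, 0 ⊑ v -> 0 ⊑ w -> vmeet (P v) (Q w) ⊑ 0,
      Q a ⊑ vmeet a b &
      P b ⊑ vmeet a b].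
Proof.
move=> a0 b0; set m := vmeet a b.
have m0 : 0 ⊑ m := vmeet_ge0 a0 b0.
have az0 : 0 ⊑ a - m by rewrite vsub_ge0; exact: vle_meetl.
have bz0 : 0 ⊑ b - m by rewrite vsub_ge0; exact: vle_meetr.
have [P [Pbd Pdisj Pz Pperp]] := band_projection az0.
exists P, (idfun \- P : {linear Y -> Y}); split => /=.
- by split=> x x0 /=; [|rewrite vsub_ge0]; have [] := Pbd x x0.
- by move=> x; rewrite addrC subrK.
- exact: Pdisj.
- rewrite vle_subl addrC -vle_subl; apply: (vle_trans _ Pz).
  rewrite linearB /= vle_subl; apply: vle_addr; exact: (Pbd m m0).1.
- have : P (b - m) ⊑ 0.
    apply: Pperp => //; rewrite -vmeetDr vmeetC -/m subrr; exact: vle_refl.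
  rewrite linearB vle_subl add0r => Pbm; apply: (vle_trans _ Pbm).
  exact: (Pbd m m0).2.
Qed.

End uniformly_monotone_lattice.

(** * Bounded operators and normalization *)

Section operator_norm.
Variables (R : realType) (X Y : normedModType R).
Implicit Types (T : {linear X -> Y}).

Lemma opnorm_has_ubound T : bounded_operator T ->
  has_ubound [set `|T x| | x in [set x | `|x| <= 1]].
Proof.
move=> [M TM]; exists (Num.max M 0) => _ [x /= x1 <-].
apply: (le_trans (TM x)); have [M0|M0] := leP M 0.
  by rewrite mulr_le0_ge0.
by rewrite ger_pMr.
Qed.

Lemma le_opnorm T x : bounded_operator T -> `|x| <= 1 -> `|T x| <= opnorm T.
Proof.
by move=> bT x1; apply: ub_le_sup; [exact: opnorm_has_ubound|exists x].
Qed.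

Lemma opnorm_le T (M : R) : (forall x, `|x| <= 1 -> `|T x| <= M) ->
  opnorm T <= M.
Proof.
move=> TM; apply: ge_sup; last by move=> _ [x x1 <-]; exact: TM.
by exists `|T 0|, 0 => //=; rewrite normr0.
Qed.

Lemma ball_bounded_operator T (M : R) :
  (forall x, `|x| <= 1 -> `|T x| <= M) -> bounded_operator T.
Proof.
move=> TM; exists M => x; have [->|x0] := eqVneq x 0.
  by rewrite linear0 !normr0 mulr0.
have nx0 : 0 < `|x| by rewrite normr_gt0.
rewrite -ler_pdivrMr// mulrC -[X in X * _]ger0_norm ?invr_ge0// -normrZ -linearZ.
by apply: TM; rewrite normrZ ger0_norm ?invr_ge0// mulVf// gt_eqF.
Qed.

End operator_norm.

(** [opnorm S = 1] and the bound [r] force [N = |T1 u0|] to lie in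
    [[1 - r, 1 + r]], so dividing by [N] moves [T1] by at most [r] once more. *)
Lemma BPB_normalization (R : realType) (X Y : banachLatticeType R)
    (S T1 : {linear X -> Y}) (u0 : X) (r eps : R) :
  unit_positive_operator S -> positive_operator T1 -> `|u0| <= 1 ->
  (forall f, `|f| <= 1 -> `|T1 f| <= `|T1 u0|) ->
  (forall f, `|f| <= 1 -> `|T1 f - S f| <= r) ->
  r < 1 -> r + r < eps ->
  exists T : {linear X -> Y},
    [/\ `|u0| = 1, unit_positive_operator T, `|T u0| = 1 &
        opnorm (T \- S) < eps].
Proof.
move=> [bS S1 pS] pT1 u01 T1u0 T1S r1 reps; set N := `|T1 u0|.
have lN : 1 <= N + r.
  rewrite -S1; apply: opnorm_le => f f1.
  rewrite -[S f](subrK (T1 f)) addrC (le_trans (ler_normD _ _))// lerD//.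
    exact: T1u0.
  by rewrite distrC; exact: T1S.
have uN : N <= 1 + r.
  rewrite /N -[T1 u0](subrK (S u0)) addrC (le_trans (ler_normD _ _))// lerD//.
    by rewrite -S1; exact: le_opnorm.
  exact: T1S.
have N0 : 0 < N by lra.
have NV0 : 0 <= N^-1 by rewrite invr_ge0 ltW.
have Tlin : linear (fun f => N^-1 *: T1 f).
  by move=> a f g; rewrite linearP scalerDr !scalerA mulrC.
pose Tl := GRing.isLinear.Build R X Y *:%R _ Tlin.
have [T TE] : exists T : {linear X -> Y}, forall f, T f = N^-1 *: T1 f.
  by exists (HB.pack_for {linear X -> Y} (fun f => N^-1 *: T1 f) Tl).
have T1' f : `|f| <= 1 -> `|T f| <= 1.
  by move=> f1; rewrite TE normrZ ger0_norm// mulrC ler_pdivrMr// mul1r T1u0.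
have bT := ball_bounded_operator T1'.
have Tu0 : `|T u0| = 1 by rewrite TE normrZ ger0_norm// mulVf// gt_eqF.
have T_1 : opnorm T = 1.
  by apply: le_anti; rewrite opnorm_le//= -Tu0; exact: le_opnorm.
exists T; split => //.
- apply: le_anti; rewrite u01/= leNgt; apply/negP => u0lt.
  have [u00|u00] := eqVneq u0 0.
    by move: Tu0; rewrite u00 linear0 normr0 => /esym/eqP; rewrite oner_eq0.
  have nu0 : 0 < `|u0| by rewrite normr_gt0.
  have := T1' (`|u0|^-1 *: u0); rewrite linearZ !normrZ Tu0 ger0_norm ?invr_ge0//.
  rewrite mulVf ?gt_eqF// mulr1 => /(_ (lexx _)).
  by rewrite invf_le1// leNgt u0lt.
- split => // f f0; rewrite TE; apply: vle_scale_ge0 => //; exact: pT1.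
- apply: (le_lt_trans _ reps); apply: opnorm_le => f f1.
  rewrite /= -(subrKA (T1 f)) (le_trans (ler_normD _ _))// lerD//; last exact: T1S.
  rewrite TE -[X in _ - X]scale1r -scalerBl normrZ.
  apply: (@le_trans _ _ (`|N^-1 - 1| * N)); first by rewrite ler_wpM2l// T1u0.
  rewrite -[X in _ * X]gtr0_norm// -normrM mulrBl mul1r mulVf ?gt_eqF//.
  by rewrite ler_norml; lra.
Qed.

(** * Positive operators that almost attain their norm *)

Lemma positive_mono (R : realType) (X Y : banachLatticeType R)
    (T : {linear X -> Y}) x y : positive_operator T -> x ⊑ y -> T x ⊑ T y.
Proof.
by move=> pT xy; rewrite -vsub_ge0 -linearB; apply: pT; rewrite vsub_ge0.
Qed.

Section almost_attaining.
Variables (R : realType) (X Y : banachLatticeType R) (S : {linear X -> Y}).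
Variables (x0 : X) (e d : R).
Hypotheses (Sunit : unit_positive_operator S) (x01 : `|x0| = 1).
Hypotheses (e0 : 0 <= e) (d01 : 0 < d <= 1).
Hypotheses (um : uniform_monotonicity_at Y e d) (Sx0 : 1 - d / 2 < `|S x0|).

Let bS : bounded_operator S. Proof. by case: Sunit. Qed.
Let S1 : opnorm S = 1. Proof. by case: Sunit. Qed.
Let pS : positive_operator S. Proof. by case: Sunit. Qed.

Let S_le1 x : `|x| <= 1 -> `|S x| <= 1.
Proof. by move=> x1; rewrite -[leRHS]S1; exact: le_opnorm. Qed.

Let Sx0_gt0 : 0 < `|S x0|.
Proof. by apply: lt_trans Sx0; have := d01; lra. Qed.

(* [eta = d / 2] is chosen for this inequality. *)
Let monotonicity_range : 1 <= (1 + d) * `|S x0|.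
Proof. by have /andP[? ?] := d01; have := Sx0; nra. Qed.

Let vabs_Sx0 :
  vabs (S x0) + vmeet (S (vpos x0)) (S (vpos (- x0))) *+ 2 = S (vabs x0).
Proof. by rewrite [vabs x0]vabs_pos_neg linearD -[RHS]vabs_sub -linearB vpos_sub. Qed.

Lemma overlap_small : `|vmeet (S (vpos x0)) (S (vpos (- x0)))| <= e / 2.
Proof.
set m := vmeet _ _.
have m0 : 0 ⊑ m by apply: vmeet_ge0; apply: pS; exact: vpos_ge0.
have Sx01 : `|S x0| <= 1 by apply: S_le1; rewrite x01.
have : `|m *+ 2| <= e * `|vabs (S x0)|.
  apply: (uniform_monotonicity_scaled um); rewrite ?norm_vabs//.
  - exact: vabs_ge0.
  - by rewrite mulr2n; exact: vge0D.
  - by rewrite vabs_Sx0 (le_trans (S_le1 _))// norm_vabs x01.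
by rewrite normrMn norm_vabs; have := e0; nra.
Qed.

Lemma complement_small g : 0 ⊑ g -> `|vabs x0 + g| <= 1 -> `|S g| <= e.
Proof.
move=> g0 xg1.
have le_Sabs : `|S x0| <= `|S (vabs x0)|.
  rewrite -vabs_Sx0 -norm_vabs; apply: norm_mono; first exact: vabs_ge0.
  apply: vle_addr; rewrite mulr2n.
  by apply: vge0D; apply: vmeet_ge0; apply: pS; exact: vpos_ge0.
have : `|S g| <= e * `|S (vabs x0)|.
  apply: (uniform_monotonicity_scaled um).
  - by apply: pS; exact: vabs_ge0.
  - exact: pS.
  - exact: lt_le_trans le_Sabs.
  - rewrite -linearD (le_trans (S_le1 xg1))// (le_trans monotonicity_range)//.
    by rewrite ler_wpM2l// addr_ge0//; have := d01; lra.
by move=> /le_trans; apply; rewrite ler_piMr// S_le1// norm_vabs x01.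
Qed.

End almost_attaining.

(** * Cutoff functions *)

Section cutoff.
Variables (R : realType) (c : R).
Hypothesis c_bnd : 2^-1 <= c < 1.

Definition ramp (t : R) : R := Num.max (t - c) 0 / (1 - c).
Definition clip (t : R) : R := Num.max (-1) (Num.min 1 (t / c)).

Let c0 : 0 < c. Proof. by have := c_bnd; lra. Qed.
Let k0 : 0 < 1 - c. Proof. by have := c_bnd; lra. Qed.

Lemma ramp_low t : t <= c -> ramp t = 0.
Proof. by move=> tc; rewrite /ramp max_r ?mul0r// subr_le0. Qed.

Lemma ramp_high t : c <= t -> ramp t = (t - c) / (1 - c).
Proof. by move=> tc; rewrite /ramp max_l// subr_ge0. Qed.

Lemma clip_high t : c <= t -> clip t = 1.
Proof.
move=> ct; have t1 : 1 <= t / c by rewrite ler_pdivlMr// mul1r.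
by rewrite /clip min_l// max_r//; lra.
Qed.

Lemma clip_low t : t <= - c -> clip t = -1.
Proof.
move=> ct; rewrite /clip max_l// ge_min; apply/orP; right.
by rewrite ler_pdivrMr// mulN1r.
Qed.

Lemma clip_mid t : - c <= t <= c -> clip t = t / c.
Proof.
move=> /andP[ct tc]; rewrite /clip min_r ?max_r//.
  by rewrite ler_pdivlMr// mulN1r.
by rewrite ler_pdivrMr// mul1r.
Qed.

Lemma ramp_ge0 t : 0 <= ramp t.
Proof. by rewrite divr_ge0 ?le_max ?lexx ?orbT// ltW. Qed.

Lemma ramp_le_pos t : t <= 1 -> ramp t <= Num.max t 0.
Proof.
move=> t1; have [tc|tc] := leP t c; first by rewrite ramp_low// le_max lexx orbT.
rewrite ramp_high ?(ltW tc)// max_l; last by move: c0; lra.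
have : 0 <= c * (1 - t) by rewrite mulr_ge0 ?subr_ge0// ltW.
by rewrite ler_pdivrMr//; nra.
Qed.

Lemma clip_ramp t : clip t * ramp t = ramp t.
Proof.
have [tc|tc] := leP t c; first by rewrite ramp_low// mulr0.
by rewrite clip_high ?mul1r// ltW.
Qed.

Lemma clip_rampN t : clip t * ramp (- t) = - ramp (- t).
Proof.
have [tc|tc] := leP (- t) c; first by rewrite ramp_low// mulr0 oppr0.
by rewrite clip_low ?mulN1r//; lra.
Qed.

Lemma clip_le1 t : `|clip t| <= 1.
Proof.
rewrite ler_norml /clip le_max lexx /= ge_max ge_min lexx/= andbT; lra.
Qed.

Lemma clip_near t : `|t| <= 1 -> `|clip t - t| <= 1 - c.
Proof.
rewrite !ler_norml => /andP[tN1 t1]; have := c_bnd => cb.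
have [ct|ct] := leP c t; first by rewrite clip_high//; lra.
have [tc|tc] := leP t (- c); first by rewrite clip_low//; lra.
rewrite clip_mid ?(ltW ct) ?(ltW tc)//.
have -> : t / c - t = (1 - c) * (t / c).
  by rewrite mulrBl mul1r [c * _]mulrC divfK// gt_eqF.
have : -1 <= t / c by rewrite ler_pdivlMr//; lra.
have : t / c <= 1 by rewrite ler_pdivrMr//; lra.
by move: (t / c) => s s1 sN1; nra.
Qed.

(** [1 / c <= 2] makes the truncation of a function vanishing at infinity vanish
    at infinity. *)
Lemma clip_dominated t : `|clip t| <= `|t| + `|t|.
Proof.
have cb := c_bnd.
have [ct|ct] := leP c t; first by rewrite clip_high// normr1 ger0_norm; lra.
have [tc|tc] := leP t (- c).
  by rewrite clip_low// normrN1 ler0_norm; lra.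
rewrite clip_mid ?(ltW ct) ?(ltW tc)// normrM.
rewrite (ger0_norm (x := c^-1)) ?invr_ge0 ?(ltW c0)//.
rewrite ler_pdivrMr//; have := normr_ge0 t; nra.
Qed.

(** The inequality that lets [complement_small] discard everything outside the
    two cutoffs; below the level [c] it reads [|t| + (1 - c) <= 1], above
    [c] it is an equality. *)
Lemma ramp_complement t : `|t| <= 1 ->
  0 <= 1 - ramp t - ramp (- t) /\
  `|t| + (1 - c) * (1 - ramp t - ramp (- t)) <= 1.
Proof.
rewrite ler_norml => /andP[tN1 t1]; have := c_bnd => cb.
have kK s : (1 - c) * (s / (1 - c)) = s by rewrite mulrC divfK// gt_eqF.
have [ct|ct] := leP c t.
  rewrite (ramp_high ct) (ramp_low (t := - t)); last lra.
  rewrite subr0 subr_ge0 ler_pdivrMr// mul1r mulrBr kK mulr1 ger0_norm; lra.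
have [tc|tc] := leP t (- c).
  rewrite (ramp_high (t := - t)) ?(ramp_low (t := t)); try lra.
  rewrite subr0 subr_ge0 ler_pdivrMr// mul1r mulrBr kK mulr1 ler0_norm; lra.
rewrite !ramp_low; try lra.
by rewrite !subr0 mulr1; have : `|t| <= c; [rewrite ler_norml|]; lra.
Qed.

Lemma continuous_ramp : continuous (ramp : R -> R).
Proof.
move=> t; apply: cvgMr_tmp.
apply: (@continuous_max R R (fun t => t - c) (fun=> 0)); last exact: cvg_cst.
by apply: cvgB; [exact: cvg_id|exact: cvg_cst].
Qed.

Lemma continuous_clip : continuous (clip : R -> R).
Proof.
move=> t.
apply: (@continuous_max R R (fun=> -1) (fun t => Num.min 1 (t / c))).
  exact: cvg_cst.
apply: (@continuous_min R R (fun=> 1)); first exact: cvg_cst.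
by apply: cvgMr_tmp; exact: cvg_id.
Qed.

End cutoff.

Section C0_functions.
Variables (R : realType) (L : topologicalType).
Implicit Types (f g : C0 R L).

Lemma C0_ball f x : `|f| <= 1 -> `|f x| <= 1.
Proof. by move=> f1; exact: le_trans (C0_norm_ge f x) f1. Qed.

Lemma C0_norm_le1 f : (forall x, `|f x| <= 1) -> `|f| <= 1.
Proof. by move=> f1; exact: C0_norm_le. Qed.

Lemma C0_vabsE f x : (vabs f : C0 R L) x = `|f x|.
Proof. exact: (maxrN (f x : R)). Qed.

Lemma C0_dominated_comp (h : R -> R) f : continuous h ->
  (forall x, `|h (f x)| <= `|f x| + `|f x|) ->
  exists g, forall x, g x = h (f x).
Proof.
move=> ch hf.
have hC : (fun x => h (f x) : R^o) \in @C0_pred R L.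
  apply: (C0_dominated (C0_funP f) (C0_funP f)) hf => x.
  by apply: (@continuous_comp _ _ _ f h); [exact: C0_continuous|exact: ch].
by exists (MkC0 hC).
Qed.

Lemma C0_multiplication g : (forall x, `|g x| <= 1) ->
  exists M : {linear C0 R L -> C0 R L}, forall f x, M f x = f x * g x.
Proof.
move=> g1.
have fgC f : (fun x => f x * g x : R^o) \in @C0_pred R L.
  apply: (C0_dominated (C0_funP f) (C0_funP f)) => x.
    by apply: cvgM; exact: C0_continuous.
  rewrite normrM ler_wpDl// -[leRHS]mulr1 ler_wpM2l//.
pose M f := MkC0 (fgC f).
have Mlin : linear M.
  move=> a f h; apply: C0_ext => x.
  have -> : M (a *: f + h) x = (a * f x + h x) * g x by [].
  have -> : (a *: M f + M h) x = a * (f x * g x) + h x * g x by [].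
  by rewrite mulrDl mulrA.
pose Ml := GRing.isLinear.Build R _ _ *:%R M Mlin.
by exists (HB.pack_for {linear C0 R L -> C0 R L} M Ml).
Qed.

End C0_functions.

(** * The property at a fixed level *)

Lemma BPBp_positive_at_C0 (R : realType) (L : topologicalType)
    (Y : banachLatticeType R) (eps d : R) :
  uniformly_monotone Y -> 0 < eps < 1 -> 0 < d <= 1 ->
  uniform_monotonicity_at Y (eps ^+ 2 / 8) d ->
  BPBp_positive_at (C0 R L) Y eps (d / 2).
Proof.
move=> umY /andP[eps0 eps1] d01 um S Sunit x0 x01 Sx0.
have pS : positive_operator S by case: Sunit.
pose e := eps ^+ 2 / 8; rewrite -/e in um.
have e0 : 0 <= e by rewrite divr_ge0// exprn_ge0// ltW.
pose c := 1 - eps / 2.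
have cb : 2^-1 <= c < 1 by rewrite /c; apply/andP; split; lra.
have kE : 1 - c = eps / 2 by rewrite /c opprB addrC subrK.
have k0 : 0 < 1 - c by rewrite kE; lra.
have x0b x : `|x0 x| <= 1 by apply: C0_ball; rewrite x01.
have x0_le x : x0 x <= 1 by have := x0b x; rewrite ler_norml => /andP[].
have x0_ge x : - x0 x <= 1 by have := x0b x; rewrite ler_norml; lra.
have ramp_dom t : t <= 1 -> `|ramp c t| <= `|t| + `|t|.
  move=> t1; rewrite ger0_norm ?ramp_ge0//.
  apply: (le_trans (ramp_le_pos cb t1)); rewrite ge_max addr_ge0// andbT.
  by rewrite (le_trans (ler_norm _))// ler_wpDr.
have [p pE] : exists p : C0 R L, forall x, p x = ramp c (x0 x).
  apply: C0_dominated_comp; first exact: continuous_ramp.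
  by move=> x; exact: ramp_dom.
have [q qE] : exists q : C0 R L, forall x, q x = ramp c (- x0 x).
  have [q qE] := @C0_dominated_comp R L (ramp c) (- x0)
    (@continuous_ramp _ c) (fun x => ramp_dom _ (x0_ge x)).
  by exists q.
have [u0 u0E] : exists u0 : C0 R L, forall x, u0 x = clip c (x0 x).
  apply: C0_dominated_comp; first exact: continuous_clip.
  by move=> x; exact: clip_dominated.
have p0 x : 0 <= p x by rewrite pE ramp_ge0.
have q0 x : 0 <= q x by rewrite qE ramp_ge0.
have pq x := ramp_complement cb (x0b x).
have p1 x : `|p x| <= 1.
  by rewrite ger0_norm//; have := q0 x; have := pq x; rewrite -pE -qE; lra.
have q1 x : `|q x| <= 1.
  by rewrite ger0_norm//; have := p0 x; have := pq x; rewrite -pE -qE; lra.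
have [Mp MpE] := C0_multiplication p1.
have [Mq MqE] := C0_multiplication q1.
pose a := S (vpos x0); pose b := S (vpos (- x0)); pose m := vmeet a b.
have a0 : 0 ⊑ a by apply: pS; exact: vpos_ge0.
have b0 : 0 ⊑ b by apply: pS; exact: vpos_ge0.
have mE : `|m| <= e / 2 := overlap_small Sunit x01 e0 d01 um Sx0.
have [P [Q [[pP pQ] PQ PQdisj Qa Pb]]] := separating_projection umY a0 b0.
pose T1 := (P \o (S \o Mp)) \+ (Q \o (S \o Mq)) : {linear C0 R L -> Y}.
have T1E f : T1 f = P (S (Mp f)) + Q (S (Mq f)) by [].
have bal (f : C0 R L) x : `|f| <= 1 -> - 1 <= f x <= 1.
  by move=> f1; rewrite -ler_norml; exact: C0_ball.
have Mp_le f : `|f| <= 1 -> Mp f ⊑ p.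
  by move=> f1 x; rewrite MpE ler_piMl//; case/andP: (bal f x f1).
have Mq_le f : `|f| <= 1 -> Mq f ⊑ q.
  by move=> f1 x; rewrite MqE ler_piMl//; case/andP: (bal f x f1).
have p_le : p ⊑ vpos x0 by move=> x; rewrite pE; exact: ramp_le_pos.
have q_le : q ⊑ vpos (- x0) by move=> x; rewrite qE; exact: ramp_le_pos.
have PS_le f g : f ⊑ g -> P (S f) ⊑ P (S g).
  by move=> fg; apply: positive_mono => //; exact: positive_mono.
have QS_le f g : f ⊑ g -> Q (S f) ⊑ Q (S g).
  by move=> fg; apply: positive_mono => //; exact: positive_mono.
have nT1u0 : `|T1 u0| = `|P (S p) + Q (S q)|.
  have -> : T1 u0 = P (S p) - Q (S q).
    rewrite T1E -!linearN; congr (P (S _) + Q (S _)); apply: C0_ext => x.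
      by rewrite MpE u0E pE clip_ramp.
    by rewrite MqE u0E qE clip_rampN// -qE.
  have Sp0 : 0 ⊑ S p by exact: pS.
  have Sq0 : 0 ⊑ S q by exact: pS.
  rewrite -norm_vabs; congr `|_|.
  by apply: vabs_sub_disjoint; [exact: pP|exact: pQ|exact: PQdisj].
have T1_le f : `|f| <= 1 -> T1 f ⊑ P (S p) + Q (S q).
  by move=> f1; apply: vleD; [exact/PS_le/Mp_le|exact/QS_le/Mq_le].
have u01 : `|u0| <= 1 by apply: C0_norm_le1 => x; rewrite u0E clip_le1.
(* The part of [f] outside the cutoffs is [f] times [1 - p - q]. *)
have outside f : `|f| <= 1 -> `|S (f - Mp f - Mq f)| <= e / (1 - c).
  move=> f1; pose g := vabs f - Mp (vabs f) - Mq (vabs f).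
  have gE x : g x = `|f x| * (1 - ramp c (x0 x) - ramp c (- x0 x)).
    rewrite [LHS](_ : _ = `|f x| - Mp (vabs f) x - Mq (vabs f) x).
      by rewrite MpE MqE C0_vabsE pE qE !mulrBr mulr1.
    by rewrite -(C0_vabsE f x).
  clearbody g.
  have fE x : (f - Mp f - Mq f) x = f x * (1 - ramp c (x0 x) - ramp c (- x0 x)).
    rewrite [LHS](_ : _ = f x - Mp f x - Mq f x)//.
    by rewrite MpE MqE pE qE !mulrBr mulr1.
  have g0 : 0 ⊑ g by move=> x; rewrite gE mulr_ge0//; exact: (pq x).1.
  apply: (@le_trans _ _ `|S g|).
    apply: norm_dominated; last rewrite -[X in X ⊑ _]linearN;
      apply: positive_mono => // x; rewrite [leRHS](gE x).
      by rewrite [leLHS](fE x) ler_wpM2r ?ler_norm//; exact: (pq x).1.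
    rewrite [leLHS](_ : _ = - ((f - Mp f - Mq f) x))// (fE x) -mulNr.
    by rewrite ler_wpM2r ?ler_normr ?lexx ?orbT//; exact: (pq x).1.
  suff : `|S ((1 - c) *: g)| <= e.
    by rewrite linearZ normrZ gtr0_norm// => h; rewrite ler_pdivlMr// mulrC.
  apply: (complement_small Sunit x01 e0 d01 um Sx0).
    by apply: vle_scale_ge0 => //; exact: ltW.
  apply: C0_norm_le1 => x.
  rewrite [X in `|X|](_ : _ = `|x0 x| + (1 - c) * g x); last first.
    by rewrite -(C0_vabsE x0 x).
  rewrite ger0_norm ?addr_ge0 ?mulr_ge0 ?(ltW k0)//; last exact: g0.
  apply: (le_trans _ (pq x).2); rewrite lerD2l ler_wpM2l ?(ltW k0)// gE.
  by rewrite ler_piMl ?C0_ball//; exact: (pq x).1.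
(* What [Q] keeps of [S (f p)] and [P] of [S (f q)] is below the overlap [m]. *)
have QMp f : `|f| <= 1 -> Q (S (Mp f)) ⊑ m.
  by move=> f1; apply: (vle_trans _ _ Qa); apply/QS_le/(vle_trans _ _ p_le)/Mp_le.
have PMq f : `|f| <= 1 -> P (S (Mq f)) ⊑ m.
  by move=> f1; apply: (vle_trans _ _ Pb); apply/PS_le/(vle_trans _ _ q_le)/Mq_le.
have near_S f : `|f| <= 1 -> `|T1 f - S f| <= e / (1 - c) + e.
  move=> f1; have fN1 : `|- f| <= 1 by rewrite normrN.
  have -> : S f = T1 f + (S (f - Mp f - Mq f) + (Q (S (Mp f)) + P (S (Mq f)))).
    rewrite T1E addrCA [X in _ = _ + X]addrACA PQ [Q _ + P _]addrC PQ.
    by rewrite !linearB /= -[_ - _ - _]addrA -opprD subrK.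
  rewrite distrC addrAC subrr add0r.
  apply: (le_trans (ler_normD _ _)); apply: lerD.
    exact: outside.
  rewrite [leRHS]splitr; apply: (le_trans (ler_normD _ _)); apply: lerD;
    apply: le_trans mE; apply: norm_dominated; rewrite -?[X in X ⊑ _]linearN.
  - exact: QMp.
  - by rewrite -!linearN; exact: QMp.
  - exact: PMq.
  - by rewrite -!linearN; exact: PMq.
(* The level [eps^2 / 8] is chosen so that twice this bound is below [eps]. *)
have rE : e / (1 - c) + e = eps / 4 + eps ^+ 2 / 8.
  by rewrite kE /e; field; rewrite gt_eqF.
have [T [nu0 uT Tu0 TS]] : exists T : {linear C0 R L -> Y},
    [/\ `|u0| = 1, unit_positive_operator T, `|T u0| = 1 &
        opnorm (T \- S) < eps].
  apply: (BPB_normalization (T1 := T1) (r := e / (1 - c) + e)) => //.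
  - move=> f f0; rewrite T1E; apply: vge0D; [apply: pP|apply: pQ];
      apply: pS => x; rewrite ?MpE ?MqE mulr_ge0//; exact: f0.
  - move=> f f1; rewrite nT1u0; apply: norm_dominated; first exact: T1_le.
    by rewrite -linearN; apply: T1_le; rewrite normrN.
  - by rewrite rE; nra.
  - by rewrite rE; nra.
exists u0, T; split => //.
apply: (@le_lt_trans _ _ (1 - c)); last by rewrite kE; lra.
apply: C0_norm_le => [|x]; first exact: ltW.
by rewrite [X in `|X|](_ : _ = u0 x - x0 x)// u0E; exact: clip_near.
Qed.

Theorem corollary2p12 (R : realType) :
  (forall (L : topologicalType) (Y : banachLatticeType R),
     hausdorff_space L -> locally_compact [set: L] -> separable (C0 R L) ->
     uniformly_monotone Y ->
     BPBp_positive (C0 R L) Y)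
  /\
  (forall delta : R -> R, (forall eps : R, 0 < eps < 1 -> 0 < delta eps <= eps) ->
   exists2 eta : R -> R, (forall eps : R, 0 < eps < 1 -> 0 < eta eps < eps) &
     forall (L : topologicalType) (Y : banachLatticeType R),
       hausdorff_space L -> locally_compact [set: L] -> separable (C0 R L) ->
       uniformly_monotone Y -> uniform_monotonicity_modulus Y delta ->
       BPBp_positive_function (C0 R L) Y eta).
Proof.
have level (eps : R) : 0 < eps < 1 -> 0 < eps ^+ 2 / 8 < eps.
  move=> /andP[eps0 eps1]; rewrite divr_gt0 ?exprn_gt0//=.
  by rewrite ltr_pdivrMr// expr2; nra.
have level01 (eps : R) : 0 < eps < 1 -> 0 < eps ^+ 2 / 8 < 1.
  move=> heps; have /andP[-> /lt_trans] := level _ heps; apply.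
  by case/andP: heps.
have half (eps d : R) : 0 < eps < 1 -> 0 < d <= eps ^+ 2 / 8 ->
    0 < d / 2 < eps /\ 0 < d <= 1.
  move=> heps /andP[d0 de]; have := level _ heps; have := level01 _ heps.
  by move: (eps ^+ 2 / 8) de => s; lra.
split=> [L Y _ _ _ umY eps heps|delta delta_bnd].
  have [d d_bnd umd] := umY _ (level01 _ heps).
  have [d2 d1] := half _ _ heps d_bnd.
  by exists (d / 2) => //; exact: BPBp_positive_at_C0.
exists (fun eps => delta (eps ^+ 2 / 8) / 2) => [eps heps|].
  exact: (half _ _ heps (delta_bnd _ (level01 _ heps))).1.
move=> L Y _ _ _ umY umd eps heps.
have [d_bnd umeps] := umd _ (level01 _ heps).
have [d2 d1] := half _ _ heps d_bnd.
by split=> //; exact: BPBp_positive_at_C0.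
Qed.
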